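(* For any $a,b,c,s,t\in(0,1)$ with $a<s$, there exists a $6$-point metric space $(L,d_L)$ that satisfies the following two conditions: (i) $L$ satisfies all Andoni–Naor–Neiman inequalities (as defined in the context); (ii) $L$ does not satisfy the following six-point inequality for the parameters $a,b,c,s,t$; that is, there exist $x_0,x_1,y_0,y_1,z_0,z_1\in L$ for which the following inequality fails: \begin{align*} &sta\big((1-t)(1-a)+(1-s)tb\big)\,d_L(x_0,x_1)^2 + s(1-t)t(1-b)b\,d_L(y_0,y_1)^2 + ab(1-c)c\,d_L(z_0,z_1)^2\\ &\quad\leq (1-s)tab(1-c)\,d_L(x_0,z_0)^2 + stab(1-c)\,d_L(x_1,z_0)^2 + (1-t)ab(1-c)\,d_L(y_1,z_0)^2\\ &\qquad + (1-s)tabc\,d_L(x_0,z_1)^2 + stabc\,d_L(x_1,z_1)^2 + (1-t)abc\,d_L(y_1,z_1)^2\\ &\qquad + s(1-t)t(1-a)(1-b)\,d_L(x_0,y_0)^2 + s(1-t)ta(1-b)\,d_L(x_1,y_0)^2 + (1-t)t(s-a)b\,d_L(x_0,y_1)^2. \end{align*}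
   Context: Write $[n]=\{1,\ldots,n\}$ for a positive integer $n$. A metric space $(X,d_X)$ is said to satisfy all Andoni–Naor–Neiman inequalities if the following holds. For all positive integers $m$ and $n$; all positive real numbers $c_1,\ldots,c_m$; all positive real numbers $p_1^k,\ldots,p_n^k,q_1^k,\ldots,q_n^k$ ($k\in[m]$) with $\sum_{i=1}^n p_i^k=\sum_{j=1}^n q_j^k=1$ for every $k\in[m]$; and all $n\times n$ matrices $A_k=(a_{ij}^k)$ and $B_k=(b_{ij}^k)$ ($k\in[m]$) with nonnegative real entries satisfying $$\sum_{r=1}^n a_{ir}^k+\sum_{r=1}^n b_{rj}^k=p_i^k+q_j^k\quad\text{for all } i,j\in[n],\ k\in[m],$$ the inequality $$\sum_{k=1}^m\ \sum_{i,j\in[n]:\,a_{ij}^k+b_{ij}^k>0}\frac{c_k a_{ij}^k b_{ij}^k}{a_{ij}^k+b_{ij}^k}\,d_X(x_i,x_j)^2\leq\sum_{k=1}^m\sum_{i=1}^n\sum_{j=1}^n c_k p_i^k q_j^k\,d_X(x_i,x_j)^2$$ holds for all points $x_1,\ldots,x_n\in X$ (not necessarily distinct). *)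

(* Defs.v *)
From HB Require Import structures.
From mathcomp Require Import all_boot all_order all_algebra.
From mathcomp Require Import all_classical all_reals all_analysis.

Set Implicit Arguments.
Unset Strict Implicit.
Unset Printing Implicit Defensive.

Import Order.TTheory GRing.Theory Num.Theory.
Local Open Scope ring_scope.

(* [A k i j] is a_ij^k, [p k i] is p_i^k, and so on. *)
Definition satisfies_all_ANN (R : realType) (X : metricType R) : Prop :=
  forall (m n : nat) (c : 'I_m -> R) (p q : 'I_m -> 'I_n -> R)
         (A B : 'I_m -> 'M[R]_n),
    (0 < m)%N -> (0 < n)%N ->
    (forall k, 0 < c k) ->
    (forall k i, 0 < p k i) ->
    (forall k j, 0 < q k j) ->
    (forall k, \sum_(i < n) p k i = 1) ->
    (forall k, \sum_(j < n) q k j = 1) ->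
    (forall k i j, 0 <= A k i j) ->
    (forall k i j, 0 <= B k i j) ->
    (forall k i j,
       \sum_(r < n) A k i r + \sum_(r < n) B k r j = p k i + q k j) ->
    forall x : 'I_n -> X,
      \sum_(k < m) \sum_(i < n) \sum_(j < n | 0 < A k i j + B k i j)
        (c k * A k i j * B k i j) / (A k i j + B k i j)
          * mdist (x i) (x j) ^+ 2
      <= \sum_(k < m) \sum_(i < n) \sum_(j < n)
           c k * p k i * q k j * mdist (x i) (x j) ^+ 2.

Definition six_point_inequality (R : realType) (X : metricType R)
    (a b c s t : R) (x0 x1 y0 y1 z0 z1 : X) : Prop :=
  s * t * a * ((1 - t) * (1 - a) + (1 - s) * t * b) * mdist x0 x1 ^+ 2
  + s * (1 - t) * t * (1 - b) * b * mdist y0 y1 ^+ 2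
  + a * b * (1 - c) * c * mdist z0 z1 ^+ 2
  <= (1 - s) * t * a * b * (1 - c) * mdist x0 z0 ^+ 2
     + s * t * a * b * (1 - c) * mdist x1 z0 ^+ 2
     + (1 - t) * a * b * (1 - c) * mdist y1 z0 ^+ 2
     + (1 - s) * t * a * b * c * mdist x0 z1 ^+ 2
     + s * t * a * b * c * mdist x1 z1 ^+ 2
     + (1 - t) * a * b * c * mdist y1 z1 ^+ 2
     + s * (1 - t) * t * (1 - a) * (1 - b) * mdist x0 y0 ^+ 2
     + s * (1 - t) * t * a * (1 - b) * mdist x1 y0 ^+ 2
     + (1 - t) * t * (s - a) * b * mdist x0 y1 ^+ 2.

(* Main.v *)
(* Place x_0, x_1, y_0, y_1 in the plane so that the segments x_0x_1 and y_0y_1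
   cross at the ratios a and b, and put both z_0 and z_1 at the point
   q = t((1-s)x_0 + s x_1) + (1-t)y_1, inside the triangle formed by the crossing
   point, x_1 and y_1.  For Euclidean distances, the right-hand side of the
   six-point inequality minus its left-hand side is
     s(1-t)t |x_a - y_b|^2 + ab |q - z_c|^2,
   which vanishes here.  Redefining only d(z_0,z_1) as a small d > 0 therefore
   violates the inequality, by ab(1-c)c d^2.

   An Andoni-Naor-Neiman inequality involves a single centre: it holds for the
   weights p, q as soon as there is u >= 0 with d(x_i,x_j) <= u_i + u_j and
   sum_i (p_i+q_i) u_i^2 <= sum_ij p_i q_j d(x_i,x_j)^2.  In the plane one takes
   u_i = |x_i - z|, z being the midpoint of the two barycentres.  This also works
   for the modified distance unless z is within d/2 of q.  In that case, as q
   lies on no segment spanned by x_0, x_1, y_0, y_1, all these four values of u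
   can be lowered a little, and this gain (of first order in d) pays for raising
   u at z_0 and z_1. *)

Require Import Defs.
From HB Require Import structures.
From mathcomp Require Import all_boot all_order all_algebra.
From mathcomp Require Import all_classical all_reals all_analysis.
From mathcomp Require Import ring lra.

Set Implicit Arguments.
Unset Strict Implicit.
Unset Printing Implicit Defensive.

Import Order.TTheory GRing.Theory Num.Theory.
Local Open Scope ring_scope.

(** * Choice of the radii at the doubled point *)

(** This is the case [max l (d - l) = d - l] of [center_height]. After the bounds
    [(l - r)^2 <= l^2 - r^2] and [v <= w1 * mu], eliminating [w0] and completing the square in [l]
    leaves exactly the last hypothesis. *)
Lemma light_cost (R : realType) (d r l w0 w1 mu v : R) :
    0 <= d -> 0 <= r -> r <= l -> 2 * l <= d ->
    0 <= w0 -> 0 <= w1 -> 0 <= mu -> w0 + w1 + mu = 1 -> v <= w1 * mu ->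
    (l - d * w1) ^+ 2 + 2 * (d * w1) * (d * mu)
      <= r ^+ 2 + 18 * (l - r) * (d * mu) ->
  (l - r) ^+ 2 * mu + w0 * (l ^+ 2 - r ^+ 2)
    + w1 * ((d - l) ^+ 2 - r ^+ 2) + d ^+ 2 * v
    <= d ^+ 2 * (w0 * w1) + 18 * (l - r) * (d * mu).
Proof.
move=> d0 r0 rl ld w00 w10 mu0 w1E vle H.
have {}w1E : w0 = 1 - w1 - mu by lra.
have h1 : (l - r) ^+ 2 * mu <= (l ^+ 2 - r ^+ 2) * mu.
  apply: ler_wpM2r => //; nra.
have h2 : d ^+ 2 * v <= d ^+ 2 * (w1 * mu) by apply: ler_wpM2l => //; exact: sqr_ge0.
rewrite w1E; nra.
Qed.

(* [r] is the distance from the planar centre to the doubled point, [w0] and [w1]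
   are the masses of its two copies, [mu] the remaining mass, and [d] the distance
   between the copies.  The copies get the radii [l] (heavy one) and
   [max l (d - l)] (light one), all other radii are lowered by [l - r], and [v]
   accounts for the asymmetry between the two weights. *)
Lemma center_height (R : realType) (d r w0 w1 mu v : R) :
    0 < d -> 0 <= r -> 0 <= w1 -> w1 <= w0 -> 0 <= mu -> w0 + w1 + mu = 1 ->
    v <= w0 * w1 -> v <= w1 * mu ->
  exists l, [/\ r <= l, l = r \/ l <= d &
    (l - r) ^+ 2 * mu + w0 * (l ^+ 2 - r ^+ 2)
      + w1 * (Num.max l (d - l) ^+ 2 - r ^+ 2) + d ^+ 2 * v
    <= d ^+ 2 * (w0 * w1) + 18 * (l - r) * (d * mu)].
Proof.
move=> d0 r0 w10 w1w0 mu0 wE v01 v1mu.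
have w00 : 0 <= w0 by exact: le_trans w1w0.
have dv : d ^+ 2 * v <= d ^+ 2 * (w0 * w1) by apply: ler_wpM2l => //; exact: sqr_ge0.
have far l : d <= 2 * l -> Num.max l (d - l) = l by move=> ?; apply/max_idPl; lra.
have near l : 2 * l <= d -> Num.max l (d - l) = d - l by move=> ?; apply/max_idPr; lra.
have y0 : 0 <= d * w1 by rewrite mulr_ge0 // ltW.
have g0 : 0 <= d * mu by rewrite mulr_ge0 // ltW.
have yd : 2 * (d * w1) + d * mu <= d by nra.
have [rd|rd] := leP d (2 * r).
  by exists r; split; [by []|by left|rewrite far //; nra].
have lc := @light_cost R d r _ w0 w1 mu v (ltW d0) r0 _ _ w00 w10 mu0 wE v1mu.
set y := d * w1 in y0 yd lc; set g := d * mu in g0 yd lc *.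
have yg : 0 <= y * g by exact: mulr_ge0.
(* The choice [l = y] makes the square in [light_cost] vanish. *)
have [ry|ry] := leP (2 * r) y.
  exists y; split; [lra|right; lra|rewrite near; last by lra].
  by apply: lc; [lra|lra|nra].
(* For [l = r] the condition of [light_cost] reads [y * (y + 2 * g - 2 * r) <= 0]. *)
have [ygr|ygr] := leP (y + 2 * g) (2 * r).
  exists r; split; [by []|by left|rewrite near; last by lra].
  by apply: lc; [by []|lra|nra].
have [ld|ld] := leP (2 * (r + y / 4)) d.
  exists (r + y / 4); split; [lra|right; lra|rewrite near //].
  by apply: lc; [lra|by []|nra].
(* Here [2 * y + g <= d < 2 * r + y / 2] and [2 * r < y + 2 * g], so [y < 2 * g] and [r] is bounded
   by a multiple of [g]. *)
exists (r + y / 4); split; [lra|right; lra|rewrite far; last exact: ltW].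
have h : (r + y / 4) ^+ 2 - r ^+ 2 <= 18 * (r + y / 4 - r) * g by nra.
have h1 : (r + y / 4 - r) ^+ 2 * mu <= ((r + y / 4) ^+ 2 - r ^+ 2) * mu.
  apply: ler_wpM2r => //; nra.
have {}wE : w0 = 1 - w1 - mu by lra.
rewrite wE in dv *; nra.
Qed.

(** * Finite metric spaces, and Andoni-Naor-Neiman inequalities from radii *)

Lemma metric_of_dist (R : realType) (T : finType) (d : T -> T -> R) :
    (forall x, d x x = 0) -> (forall x y, d x y = 0 -> x = y) ->
    (forall x y, d x y = d y x) -> (forall y x z, d x z <= d x y + d y z) ->
  exists (L : metricType R) (f : T -> L),
    bijective f /\ forall x y, mdist (f x) (f y) = d x y.
Proof.
move=> dxx d_inj dC d_tri.
pose dm := isMetric.Build R T dxx d_inj dC d_tri.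
pose L : metricType R := HB.pack (Finite.sort T) dm.
by exists L, (idfun : T -> L); split => //; exists idfun.
Qed.

(** Each summand on the left is at most [c * (A * u_i^2 + B * u_j^2)]. In the sum, [u_i^2] collects
    row i of [A] and column i of [B], that is [p_i + q_i] by the constraint at j = i. *)
Lemma ANN_of_centers (R : realType) (T : finType) (L : metricType R) (f : T -> L) :
    bijective f ->
    (forall P Q : T -> R, (forall t, 0 <= P t) -> (forall t, 0 <= Q t) ->
       \sum_t P t = 1 -> \sum_t Q t = 1 ->
     exists u : T -> R, (forall t s, mdist (f t) (f s) <= u t + u s) /\
       \sum_t (P t + Q t) * u t ^+ 2
         <= \sum_t \sum_s P t * Q s * mdist (f t) (f s) ^+ 2) ->
  satisfies_all_ANN L.
Proof.
move=> [g gK fK] centers m n c p q A B _ _ c0 p0 q0 p1 q1 A0 B0 AB x.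
apply: ler_sum => k _.
(* Points may repeat, so the weights are collected on [T]. *)
pose push (r : 'I_n -> R) t := \sum_(i | g (x i) == t) r i.
have pushE r (F : T -> R) : \sum_t push r t * F t = \sum_i r i * F (g (x i)).
  rewrite (partition_big (g \o x) predT) //=; apply: eq_bigr => t _.
  by rewrite /push mulr_suml; apply: eq_bigr => i /eqP <-.
have push1 r : \sum_t push r t = \sum_i r i.
  by have := pushE r (fun=> 1); under eq_bigr do rewrite mulr1; move->; apply: eq_bigr => i _; rewrite mulr1.
have push0 r : (forall i, 0 < r i) -> forall t, 0 <= push r t.
  by move=> r0 t; apply: sumr_ge0 => i _; exact: ltW.
have [u [ud uPQ]] := centers (push (p k)) (push (q k))
  (push0 _ (p0 k)) (push0 _ (q0 k)) (etrans (push1 _) (p1 k)) (etrans (push1 _) (q1 k)).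
pose v i := u (g (x i)).
have vd i j : mdist (x i) (x j) <= v i + v j.
  by have := ud (g (x i)) (g (x j)); rewrite !fK.
have vpq : \sum_i (p k i + q k i) * v i ^+ 2
    <= \sum_i \sum_j p k i * q k j * mdist (x i) (x j) ^+ 2.
  have := uPQ; under eq_bigr do rewrite mulrDl.
  rewrite big_split /= !pushE -big_split /=.
  under eq_bigr do rewrite -mulrDl.
  move=> /le_trans; apply.
  under eq_bigr => t _ do
    (under eq_bigr do rewrite -mulrA; rewrite -mulr_sumr pushE).
  rewrite pushE; apply: ler_sum => i _; rewrite mulr_sumr.
  by apply: ler_sum => j _; rewrite !fK mulrA.
apply: (@le_trans _ _ (\sum_i \sum_j c k * (A k i j * v i ^+ 2 + B k i j * v j ^+ 2))).
  apply: ler_sum => i _; rewrite [leLHS]big_mkcond; apply: ler_sum => j _.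
  have h0 : 0 <= c k * (A k i j * v i ^+ 2 + B k i j * v j ^+ 2).
    by rewrite mulr_ge0 ?(ltW (c0 k)) // addr_ge0 // mulr_ge0 ?A0 ?B0 // sqr_ge0.
  case: ifPn => // AB0.
  rewrite -!mulrA ler_pM2l // [_^-1 * _]mulrC !mulrA ler_pdivrMr //.
  have h1 : mdist (x i) (x j) ^+ 2 <= (v i + v j) ^+ 2.
    by rewrite lerXn2r ?nnegrE ?mdist_ge0 // (le_trans (mdist_ge0 _ _) (vd i j)).
  have h2 := ler_wpM2l (mulr_ge0 (A0 k i j) (B0 k i j)) h1.
  (* (A + B)(A u^2 + B v^2) - A B (u + v)^2 = (A u - B v)^2 *)
  have h3 := sqr_ge0 (A k i j * v i - B k i j * v j).
  nra.
under eq_bigr do rewrite -mulr_sumr.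
rewrite -mulr_sumr.
under [leRHS]eq_bigr => i _ do
  (under eq_bigr do rewrite -!mulrA; rewrite -mulr_sumr).
rewrite -mulr_sumr ler_pM2l //.
apply: (@le_trans _ _ (\sum_i (p k i + q k i) * v i ^+ 2)).
  under eq_bigr do rewrite big_split /=.
  rewrite big_split /= [X in _ + X]exchange_big -big_split /=.
  apply: ler_sum => i _.
  by rewrite -!mulr_suml -mulrDl AB.
move/le_trans: vpq; apply; apply: ler_sum => i _.
by apply: ler_sum => j _; rewrite mulrA.
Qed.

(** With [MP] and [MQ] the two means of [X], the right side minus the left side is
    [(MP - MQ)^2 / 2]. *)
Lemma variance_le (R : realType) (T : finType) (P Q X : T -> R) (z : R) :
    \sum_t P t = 1 -> \sum_t Q t = 1 ->
    2 * z = \sum_t P t * X t + \sum_t Q t * X t ->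
  \sum_t (P t + Q t) * (X t - z) ^+ 2
    <= \sum_t \sum_s P t * Q s * (X t - X s) ^+ 2.
Proof.
move=> P1 Q1.
set MP := \sum_t P t * X t; set MQ := \sum_t Q t * X t => zE.
set VP := \sum_t P t * X t ^+ 2; set VQ := \sum_t Q t * X t ^+ 2.
have -> : \sum_t (P t + Q t) * (X t - z) ^+ 2
    = VP + VQ - 2 * z * (MP + MQ) + 2 * z ^+ 2.
  transitivity (\sum_t (P t * X t ^+ 2 + Q t * X t ^+ 2
      - 2 * z * (P t * X t + Q t * X t) + z ^+ 2 * (P t + Q t))).
    by apply: eq_bigr => t _; ring.
  rewrite !big_split /= sumrN -!mulr_sumr !big_split /= P1 Q1 -/VP -/VQ -/MP -/MQ.
  ring.
have -> : \sum_t \sum_s P t * Q s * (X t - X s) ^+ 2 = VP + VQ - 2 * MP * MQ.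
  transitivity (\sum_t (P t * X t ^+ 2 - 2 * MQ * (P t * X t) + VQ * P t)).
    apply: eq_bigr => t _.
    transitivity (\sum_s (P t * X t ^+ 2 * Q s - 2 * (P t * X t) * (Q s * X s)
        + P t * (Q s * X s ^+ 2))).
      by apply: eq_bigr => s _; ring.
    rewrite !big_split /= sumrN -!mulr_sumr Q1 -/MQ -/VQ; ring.
  rewrite !big_split /= sumrN -!mulr_sumr P1 -/VP -/MP; ring.
have := sqr_ge0 (MP - MQ); rewrite -zE; nra.
Qed.

(** * The Euclidean plane *)

Definition pnorm (R : rcfType) (v : R * R) : R := Num.sqrt (v.1 ^+ 2 + v.2 ^+ 2).

Lemma pnorm_ge0 (R : rcfType) (v : R * R) : 0 <= pnorm v.
Proof. exact: sqrtr_ge0. Qed.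

Lemma sqr_pnorm (R : rcfType) (v : R * R) : pnorm v ^+ 2 = v.1 ^+ 2 + v.2 ^+ 2.
Proof. by rewrite sqr_sqrtr // addr_ge0 // sqr_ge0. Qed.

Lemma pnorm0 (R : rcfType) : pnorm (0 : R * R) = 0.
Proof. by rewrite /pnorm /= !expr0n /= addr0 sqrtr0. Qed.

Lemma pnormN (R : rcfType) (v : R * R) : pnorm (- v) = pnorm v.
Proof. by rewrite /pnorm /= !sqrrN. Qed.

Lemma pnormBC (R : rcfType) (v w : R * R) : pnorm (v - w) = pnorm (w - v).
Proof. by rewrite -pnormN opprB. Qed.

Lemma pnorm_eq0 (R : rcfType) (v : R * R) : pnorm v = 0 -> v = 0.
Proof.
move=> v0; have := sqr_pnorm v; rewrite v0 expr0n /= => /esym/eqP.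
rewrite paddr_eq0 ?sqr_ge0 // !sqrf_eq0 => /andP[/eqP v1 /eqP v2].
by case: v v1 v2 {v0} => /= ? ? -> ->.
Qed.

Lemma cauchy_schwarz2 (R : rcfType) (v w : R * R) :
  - (v.1 * w.1 + v.2 * w.2) <= pnorm v * pnorm w.
Proof.
have vw0 : 0 <= pnorm v * pnorm w by rewrite mulr_ge0 ?pnorm_ge0.
rewrite leNgt; apply/negP => lt.
have := ltr_pXn2r (n := 2) isT vw0 (le_trans vw0 (ltW lt)).
rewrite lt exprMn !sqr_pnorm.
have := sqr_ge0 (v.1 * w.2 - v.2 * w.1); nra.
Qed.

Lemma pnormB_le (R : rcfType) (v w : R * R) : pnorm (v - w) <= pnorm v + pnorm w.
Proof.
rewrite -(@ler_pXn2r _ 2) ?nnegrE ?addr_ge0 ?pnorm_ge0 //.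
have := cauchy_schwarz2 v w; rewrite sqrrD !sqr_pnorm /=; nra.
Qed.

Lemma pnorm_triangle (R : rcfType) (v w z : R * R) :
  pnorm (v - z) <= pnorm (v - w) + pnorm (w - z).
Proof.
have -> : v - z = (v - w) - (z - w) by rewrite opprB addrA subrK.
by rewrite [X in _ <= _ + X]pnormBC pnormB_le.
Qed.

(** Equality would force equality in Cauchy-Schwarz, whose defect is the square of the cross
    product. *)
Lemma pnormB_lt (R : rcfType) (v w : R * R) :
  v.1 * w.2 - v.2 * w.1 != 0 -> pnorm (v - w) < pnorm v + pnorm w.
Proof.
move=> vw; rewrite lt_neqAle pnormB_le andbT; apply: contra vw => /eqP vw.
have := congr1 (fun x => x ^+ 2) vw; rewrite sqrrD !sqr_pnorm /= => {}vw.
have {}vw : pnorm v * pnorm w = - (v.1 * w.1 + v.2 * w.2) by lra.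
have := congr1 (fun x => x ^+ 2) vw; rewrite exprMn !sqr_pnorm => {}vw.
rewrite -sqrf_eq0; apply/eqP; nra.
Qed.

(** * Radii for the doubled configuration *)

(* A planar configuration together with two copies [inr false], [inr true] of
   the origin, which are at distance [d] from each other. *)
Definition doubled_pos (R : rcfType) (O : finType) (pos : O -> R * R)
  (t : O + bool) : R * R := if t is inl o then pos o else 0.

Definition doubled_dist (R : rcfType) (O : finType) (pos : O -> R * R) (d : R)
    (t s : O + bool) : R :=
  match t, s with
  | inr b, inr b' => if b == b' then 0 else d
  | _, _ => pnorm (doubled_pos pos t - doubled_pos pos s)
  end.

Lemma doubled_centers_light (R : realType) (O : finType) (pos : O -> R * R) (d : R)
    (P Q : O + bool -> R) (b : bool) :
    0 < d -> (forall o, 10 * d <= pnorm (pos o)) ->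
    (forall o o', pnorm (pos o - pos o') + 2 * d <= pnorm (pos o) + pnorm (pos o')) ->
    (forall t, 0 <= P t) -> (forall t, 0 <= Q t) ->
    \sum_t P t = 1 -> \sum_t Q t = 1 ->
    P (inr b) + Q (inr b) <= P (inr (~~ b)) + Q (inr (~~ b)) ->
  exists u : O + bool -> R,
    (forall t s, doubled_dist pos d t s <= u t + u s) /\
    \sum_t (P t + Q t) * u t ^+ 2
      <= \sum_t \sum_s P t * Q s * doubled_dist pos d t s ^+ 2.
Proof.
move=> d0 posd slack P0 Q0 P1 Q1 light.
pose X := doubled_pos pos.
pose bary i := (\sum_t P t * i (X t) + \sum_t Q t * i (X t)) / 2.
pose z : R * R := (bary fst, bary snd).
pose W t := P t + Q t.
have W0 t : 0 <= W t by rewrite addr_ge0.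
pose WO := \sum_o W (inl o).
have WO0 : 0 <= WO by apply: sumr_ge0.
have sumT (F : O + bool -> R) :
    \sum_t F t = \sum_o F (inl o) + F (inr b) + F (inr (~~ b)).
  rewrite big_sumType /= big_bool /= -addrA; congr (_ + _).
  by case: (b) => //=; rewrite addrC.
have [PE QE] := (sumT P, sumT Q); rewrite P1 in PE; rewrite Q1 in QE.
set PO := \sum_o P (inl o) in PE; set QO := \sum_o Q (inl o) in QE.
have PO0 : 0 <= PO by apply: sumr_ge0.
have QO0 : 0 <= QO by apply: sumr_ge0.
have WOE : WO = PO + QO by rewrite -big_split.
have := (P0 (inr b), P0 (inr (~~ b)), (Q0 (inr b), Q0 (inr (~~ b)))).
case=> -[Pb0 Pc0] [Qb0 Qc0].
have [b1 b2] := (mulr_ge0 Pb0 Qc0, mulr_ge0 Pc0 Qb0).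
have [b3 b4] := (mulr_ge0 PO0 Pb0, mulr_ge0 QO0 Qb0).
have b5 := sqr_ge0 (P (inr b) - Q (inr b)).
(* The differences [P - Q] sum to zero; this gives [v <= w1 * mu] below. *)
have v0E : P (inr (~~ b)) - Q (inr (~~ b)) = QO - PO - (P (inr b) - Q (inr b)) by lra.
(* Masses are halved because [P + Q] has total 2. With [w0], [w1] the half-masses of the copies, the
   cross term [P_0 Q_1 + P_1 Q_0] equals [2 * (w0 * w1 - v)]. *)
pose v := (P (inr (~~ b)) - Q (inr (~~ b))) * (P (inr b) - Q (inr b)) / 4.
have [l [rl lrd lP]] := @center_height R d (pnorm z) (W (inr (~~ b)) / 2)
    (W (inr b) / 2) (WO / 2) v d0 (pnorm_ge0 _)
    ltac:(rewrite /W; lra) ltac:(rewrite /W; lra) ltac:(lra) ltac:(rewrite /W; lra)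
    ltac:(rewrite /v /W; lra) ltac:(rewrite /v /W v0E WOE; lra).
set r := pnorm z in rl lrd lP.
have r0 : 0 <= r by exact: pnorm_ge0.
pose N o := pnorm (pos o - z).
have posN o : pnorm (pos o) <= N o + r.
  by have := pnorm_triangle (pos o) z 0; rewrite !subr0.
pose u (t : O + bool) := match t with
  | inl o => N o - (l - r)
  | inr c => if c == b then Num.max l (d - l) else l
  end.
have l0 : 0 <= l by exact: le_trans rl.
have lmax : l <= Num.max l (d - l) by rewrite le_max lexx.
have dmax : d - l <= Num.max l (d - l) by rewrite le_max lexx orbT.
have lu c : l <= u (inr c) by rewrite /u; case: eqP.
exists u; split.
  have oz o c : pnorm (pos o) <= u (inl o) + u (inr c).
    by have := posN o; have := lu c; rewrite {2}/u; lra.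
  case=> [x|c] [x'|c'] /=.
  (* If [l = r], this is the triangle inequality through [z]. Otherwise the two radii sum to at
     least the two norms minus [2 * l], and [slack] absorbs this since [l <= d]. *)
  - case: lrd => [->|ld].
      rewrite subrr !subr0 /N [pnorm (pos x' - _)]pnormBC; exact: pnorm_triangle.
    have := slack x x'; have := posN x; have := posN x'; lra.
  - by rewrite subr0; exact: oz.
  - by rewrite sub0r pnormN addrC; exact: oz.
  - have [lc lc'] := (lu c, lu c'); case: ifPn => [_|cc'].
      by rewrite addr_ge0 // (le_trans l0).
    rewrite /u; have [cb|cb] := eqVneq c b; have [c'b|c'b] := eqVneq c' b; try lra.
    by case: (c) (c') (b) cc' cb c'b => [] [] [].
have VX : \sum_t W t * pnorm (X t - z) ^+ 2
    <= \sum_t \sum_s P t * Q s * pnorm (X t - X s) ^+ 2.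
  have V1 := @variance_le R _ P Q (fun t => (X t).1) z.1 P1 Q1 ltac:(rewrite /z /bary /=; lra).
  have V2 := @variance_le R _ P Q (fun t => (X t).2) z.2 P1 Q1 ltac:(rewrite /z /bary /=; lra).
  under eq_bigr do rewrite sqr_pnorm mulrDr.
  rewrite big_split /=; apply: le_trans (lerD V1 V2) _.
  rewrite -big_split /=; apply: ler_sum => t _; rewrite -big_split /=.
  by apply: ler_sum => s _; rewrite -mulrDr sqr_pnorm.
pose cross (t s : O + bool) : R := match t, s with
  | inr c, inr c' => (c != c')%:R
  | _, _ => 0
  end.
have dE t s : doubled_dist pos d t s ^+ 2 = pnorm (X t - X s) ^+ 2 + d ^+ 2 * cross t s.
  case: t s => [x|c] [x'|c'] /=; rewrite ?mulr0 ?addr0 //.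
  by rewrite subrr pnorm0 expr0n add0r; case: eqP => _ /=; rewrite ?mulr1 // mulr0 expr0n.
have -> : \sum_t \sum_s P t * Q s * doubled_dist pos d t s ^+ 2
    = \sum_t \sum_s P t * Q s * pnorm (X t - X s) ^+ 2
      + d ^+ 2 * (P (inr b) * Q (inr (~~ b)) + P (inr (~~ b)) * Q (inr b)).
  under eq_bigr => t _ do (under eq_bigr do rewrite dE mulrDr; rewrite big_split /=).
  rewrite big_split /=; congr (_ + _).
  have crossO t : \sum_o P t * Q (inl o) * (d ^+ 2 * cross t (inl o)) = 0.
    by rewrite big1 // => o _; case: t => [?|?] /=; rewrite !mulr0.
  rewrite sumT big1 => [|o _]; last by rewrite big1 // => s _; rewrite /= !mulr0.
  by rewrite !sumT !crossO /=; case: (b) => /=; ring.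
have zN : pnorm (0 - z) = r by rewrite sub0r pnormN.
rewrite sumT /= zN in VX.
rewrite sumT /= eqxx; have -> : (~~ b == b) = false by case: (b).
(* Lowering [N] by h = [l - r] saves [2 * h * N - h^2]. If h is nonzero then [r <= l <= d], so
   [N >= 10 * d - r >= 9 * d]; hence the constant 18. *)
have uO : \sum_o W (inl o) * (N o - (l - r)) ^+ 2
    <= \sum_o W (inl o) * N o ^+ 2 - (18 * (l - r) * d) * WO + (l - r) ^+ 2 * WO.
  rewrite -addrA -mulNr -mulrDl /WO mulr_sumr -big_split /=.
  apply: ler_sum => o _; rewrite [X in _ <= _ + X]mulrC -mulrDr.
  apply: ler_wpM2l => //.
  have : (l - r) * (9 * d) <= (l - r) * N o.
    case: lrd => [->|ld]; first by rewrite subrr !mul0r.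
    by apply: ler_wpM2l; [lra|have := posN o; have := posd o; lra].
  nra.
move: uO VX lP; rewrite /v /W -/r.
set S1 := \sum_o _ * N _ ^+ 2; set S2 := \sum_o _ * _ ^+ 2; set E := \sum_t _.
lra.
Qed.

Lemma doubled_centers (R : realType) (O : finType) (pos : O -> R * R) (d : R)
    (P Q : O + bool -> R) :
    0 < d -> (forall o, 10 * d <= pnorm (pos o)) ->
    (forall o o', pnorm (pos o - pos o') + 2 * d <= pnorm (pos o) + pnorm (pos o')) ->
    (forall t, 0 <= P t) -> (forall t, 0 <= Q t) ->
    \sum_t P t = 1 -> \sum_t Q t = 1 ->
  exists u : O + bool -> R,
    (forall t s, doubled_dist pos d t s <= u t + u s) /\
    \sum_t (P t + Q t) * u t ^+ 2
      <= \sum_t \sum_s P t * Q s * doubled_dist pos d t s ^+ 2.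
Proof.
move=> d0 posd slack P0 Q0 P1 Q1.
have [light|/ltW light] := leP (P (inr true) + Q (inr true)) (P (inr false) + Q (inr false)).
  exact: (@doubled_centers_light _ _ _ _ _ _ true).
exact: (@doubled_centers_light _ _ _ _ _ _ false).
Qed.

Lemma doubled_space_ANN (R : realType) (O : finType) (pos : O -> R * R) (d : R) :
    0 < d -> injective pos -> (forall o, 10 * d <= pnorm (pos o)) ->
    (forall o o', pnorm (pos o - pos o') + 2 * d <= pnorm (pos o) + pnorm (pos o')) ->
  exists (L : metricType R) (f : O + bool -> L),
    [/\ bijective f, forall t s, mdist (f t) (f s) = doubled_dist pos d t s &
        satisfies_all_ANN L].
Proof.
move=> d0 pos_inj posd slack.
have pos_gt0 o : 0 < pnorm (pos o) by apply: lt_le_trans (posd o); lra.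
have [||||L [f [f_bij fd]]] := @metric_of_dist R (O + bool)%type (doubled_dist pos d).
- by case=> [x|c] /=; rewrite ?subrr ?pnorm0 ?eqxx.
- move=> [x|c] [x'|c'] /=.
  + by move=> /pnorm_eq0/subr0_eq/pos_inj ->.
  + by rewrite subr0 => x0; have := pos_gt0 x; rewrite x0 ltxx.
  + by rewrite sub0r pnormN => x0; have := pos_gt0 x'; rewrite x0 ltxx.
  + by case: eqP => [->|_ dE] //; move: d0; rewrite dE ltxx.
- by move=> [x|c] [x'|c'] /=; rewrite 1?pnormBC // eq_sym.
- have d_ge0 := ltW d0.
  move=> [y|cy] [x|cx] [z|cz] /=; rewrite ?sub0r ?subr0 ?pnormN.
  + exact: pnorm_triangle.
  + by have := pnorm_triangle (pos x) (pos y) 0; rewrite !subr0.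
  + by have := pnorm_triangle 0 (pos y) (pos z); rewrite !sub0r !pnormN.
  + by have := posd y; case: ifP => _; lra.
  + exact: pnormB_le.
  + by case: ifP => _; lra.
  + by case: ifP => _; lra.
  + by case: cx cy cz => [] [] [] /=; lra.
exists L, f; split=> //; apply: (ANN_of_centers f_bij) => P Q P0 Q0 P1 Q1.
have [u [ud uPQ]] := doubled_centers d0 posd slack P0 Q0 P1 Q1.
exists u; split=> [t s|]; first by rewrite fd.
by under [leRHS]eq_bigr do under eq_bigr do rewrite fd.
Qed.

(** * Choice of the distance [d] *)

Lemma pos_lower_bound (R : realType) (T : finType) (F : T -> R) :
  (forall t, 0 < F t) -> exists2 d, 0 < d & forall t, d <= F t.
Proof.
move=> F0; exists (\big[Num.min/1]_t F t); first by apply/lt_bigmin.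
by move=> t; apply: bigmin_le.
Qed.

(** No two distinct points are collinear with the origin, so the triangle inequalities through it
    are strict, and finitely many positive gaps have a positive lower bound. *)
Lemma doubled_scale (R : realType) (O : finType) (pos : O -> R * R) :
    (forall o, pos o != 0) ->
    (forall o o', o != o' ->
       (pos o).1 * (pos o').2 - (pos o).2 * (pos o').1 != 0) ->
  exists d, [/\ 0 < d, forall o, 10 * d <= pnorm (pos o) &
    forall o o', pnorm (pos o - pos o') + 2 * d <= pnorm (pos o) + pnorm (pos o')].
Proof.
move=> pos0 cross.
have pos_gt0 o : 0 < pnorm (pos o).
  rewrite lt_neqAle pnorm_ge0 andbT eq_sym; apply: contra (pos0 o).
  by move=> /eqP/pnorm_eq0 ->.
have [d1 d10 d1P] := pos_lower_bound pos_gt0.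
have [[x x']|d2 d20 d2P] := @pos_lower_bound R (O * O)%type (fun oo =>
    pnorm (pos oo.1) + pnorm (pos oo.2) - pnorm (pos oo.1 - pos oo.2)).
  rewrite subr_gt0 /=; have [->|xx'] := eqVneq x x'; last exact/pnormB_lt/cross.
  by rewrite subrr pnorm0 addr_gt0.
exists (Num.min (d1 / 10) (d2 / 2)); split=> [|x|x x'].
- by rewrite lt_min; apply/andP; split; lra.
- have : Num.min (d1 / 10) (d2 / 2) <= d1 / 10 by rewrite ge_min lexx.
  by have := d1P x; lra.
- have : Num.min (d1 / 10) (d2 / 2) <= d2 / 2 by rewrite ge_min lexx orbT.
  by have := d2P (x, x') => /=; lra.
Qed.

(** * The six-point space *)

Local Open Scope classical_set_scope.
Local Open Scope card_scope.

Lemma card_eq_fintype (T : finType) (U : Type) (f : T -> U) :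
  bijective f -> [set: U] #= `I_#|T|.
Proof.
move=> [g gK fK]; apply/card_set_bijP; exists (fun x => enum_rank (g x) : nat).
split=> [x _|x y _ _ /ord_inj/enum_rank_inj/(can_inj fK) //|k /= kT].
  exact: ltn_ord.
by exists (f (enum_val (Ordinal kT))) => //; rewrite gK enum_valK.
Qed.

(* [(false, i)] is x_i and [(true, i)] is y_i; the crossing point of the segments
   is translated from the origin to -q. *)
Definition six_pos (R : realType) (a b s t : R) (o : bool * bool) : R * R :=
  let: (y, i) := o in
  (if y then (0, i%:R - b) else (i%:R - a, 0)) - (t * (s - a), (1 - t) * (1 - b)).

Theorem corollary1p5 (R : realType) (a b c s t : R)
    (ha : 0 < a < 1) (hb : 0 < b < 1) (hc : 0 < c < 1)
    (hs : 0 < s < 1) (ht : 0 < t < 1) (has : a < s) :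
  exists L : metricType R,
    [/\ [set: L] #= `I_6,
        satisfies_all_ANN L &
        exists x0 x1 y0 y1 z0 z1 : L,
          ~ six_point_inequality a b c s t x0 x1 y0 y1 z0 z1].
Proof.
move: ha hb hc hs ht => /andP[a0 a1] /andP[b0 b1] /andP[c0 c1] /andP[s0 s1] /andP[t0 t1].
pose pos := six_pos a b s t.
have [sa0 t10 b10 s10] : [/\ 0 < s - a, 0 < 1 - t, 0 < 1 - b & 0 < 1 - s].
  by split; lra.
(* Relative to the crossing point, q is [(t * (s - a), (1 - t) * (1 - b))]. The signs up to [albe]
   put q strictly inside the triangle; the quantity in [albe] equals [t * (1 - b) * (1 - s)]. *)
have al0 : 0 < t * (s - a) by exact: mulr_gt0.
have be0 : 0 < (1 - t) * (1 - b) by exact: mulr_gt0.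
have al1 : 0 < 1 - a - t * (s - a) by nra.
have be1 : 0 < 1 - b - (1 - t) * (1 - b).
  by have := mulr_gt0 t0 b10; lra.
have albe : 0 < (1 - a - t * (s - a)) * (1 - b - (1 - t) * (1 - b))
    - t * (s - a) * ((1 - t) * (1 - b)).
  by have := mulr_gt0 (mulr_gt0 t0 b10) s10; lra.
have pos_cross o o' : o != o' ->
    (pos o).1 * (pos o').2 - (pos o).2 * (pos o').1 != 0.
  rewrite /pos /six_pos.
  set al := t * (s - a) in al0 al1 albe *.
  set be := (1 - t) * (1 - b) in be0 be1 albe *.
  have := (mulr_gt0 al0 be0, mulr_gt0 a0 b0, mulr_gt0 a0 be0, (mulr_gt0 al0 b0,
    mulr_gt0 a0 be1, mulr_gt0 al0 be1, (mulr_gt0 al1 b0, mulr_gt0 al1 be0))).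
  move=> [[[h1 h2] h3] [[[h4 h5] h6] [h7 h8]]].
  by case: o o' => [[] []] [[] []] //= _; apply/negP => /eqP; lra.
have pos_neq0 o : pos o != 0.
  apply/eqP => o0; have := pos_cross o (~~ o.1, o.2); rewrite o0 /= !mul0r subrr eqxx.
  by case: o {o0} => [[] []] /(_ isT).
have pos_inj : injective pos.
  move=> o o' oo'; apply/eqP/negPn/negP => /pos_cross.
  by rewrite oo' mulrC subrr eqxx.
have [d [d0 posd slack]] := doubled_scale pos_neq0 pos_cross.
have [L [f [f_bij fd L_ANN]]] := doubled_space_ANN d0 pos_inj posd slack.
exists L; split=> //.
  by have := card_eq_fintype f_bij; rewrite card_sum card_prod card_bool.
exists (f (inl (false, false))), (f (inl (false, true))), (f (inl (true, false))),
  (f (inl (true, true))), (f (inr false)), (f (inr true)).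
rewrite /six_point_inequality !fd /= !sqr_pnorm /=.
have := mulr_gt0 (mulr_gt0 (mulr_gt0 a0 b0) (mulr_gt0 c0 (_ : 0 < 1 - c))) (exprn_gt0 2 d0).
by move/(_ ltac:(lra)) => D; lra.
Qed.
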